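(* Let $\psi$ be a $C^2$ convex function defined on $\mathbb{R}^+=[0,+\infty)$. Assume that $\psi$ is uniformly convex on $[0,A]$ for each $A>0$ (i.e. $\inf_{0\le v\le A}\psi''(v)>0$), that $\psi(1)=0$ and that $\lim_{u\to+\infty}\psi(u)/u=+\infty$. Then there exists a constant $c_\psi>0$ such that for every pair $(\mathbb{P},\mathbb{Q})$ of probability measures (on the same measurable space), $$\|\mathbb{P}-\mathbb{Q}\|_{TV}\le c_\psi\,\sqrt{I_\psi(\mathbb{Q}|\mathbb{P})},$$ where $$I_\psi(\mathbb{Q}|\mathbb{P})=\int\psi\left(\frac{d\mathbb{Q}}{d\mathbb{P}}\right)d\mathbb{P}$$ if $\mathbb{Q}$ is absolutely continuous with respect to $\mathbb{P}$, and $I_\psi(\mathbb{Q}|\mathbb{P})=+\infty$ otherwise.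
   Context: The total variation distance is normalized so that, when $\mathbb{Q}=h\,\mathbb{P}$, $\|\mathbb{Q}-\mathbb{P}\|_{TV}=\int|h-1|\,d\mathbb{P}$. *)

(* Defs.v *)
From HB Require Import structures.
From mathcomp Require Import all_boot all_order all_algebra.
From mathcomp Require Import all_classical all_reals all_analysis.

Set Implicit Arguments.
Unset Strict Implicit.
Unset Printing Implicit Defensive.

Import Order.TTheory GRing.Theory Num.Theory.
Import numFieldNormedType.Exports.

Local Open Scope classical_set_scope.
Local Open Scope ring_scope.

(* The difference quotient at x is taken along points of D only, so that for
   D = [0, +oo[ the derivative at 0 is the right derivative, and the values of
   f outside D are irrelevant. *)
Definition diff_quotient {R : realType} (f : R -> R) (x y : R) : R :=
  (f y - f x) / (y - x).

Definition derivable_within {R : realType} (D : set R) (f : R -> R) (x : R) :=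
  cvg (diff_quotient f x y @[y --> within D x^']).

Definition derive_within {R : realType} (D : set R) (f : R -> R) (x : R) : R :=
  lim (diff_quotient f x y @[y --> within D x^']).

Definition derive2_within {R : realType} (D : set R) (f : R -> R) : R -> R :=
  derive_within D (derive_within D f).

Definition C2_within {R : realType} (D : set R) (f : R -> R) : Prop :=
  [/\ forall x, D x -> derivable_within D f x,
      forall x, D x -> derivable_within D (derive_within D f) x &
      {within D, continuous (derive2_within D f)}].

(* |nu|(T) = nu^+(T) + nu^-(T); the choice of the Hahn decomposition is
   immaterial by Hahn_decomposition_uniq. *)
Definition tv_norm {R : realType} d {T : measurableType d}
    (nu : {charge set T -> \bar R}) : \bar R :=
  charge_variation (svalP (cid (svalP (cid (Hahn_decomposition nu))))) setT.

(* No factor 1/2: the distance is the integral of |h - 1| with respect to Q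
   when P = h Q, and it ranges over [0, 2]. *)
Definition tv_dist {R : realType} d {T : measurableType d}
    (P Q : probability T R) : \bar R :=
  tv_norm (cadd (charge_of_finite_measure P)
                (copp (charge_of_finite_measure Q))).

(* I_psi(Q | P). Radon_Nikodym_SigmaFinite.f is the library's version of dQ/dP
   which is nonnegative and finite at every point (f_ge0, f_fin_num), whereas
   Radon_Nikodym is nonnegative only P-almost everywhere; so psi is evaluated
   on [0, +oo[ only. *)
Definition rel_entropy {R : realType} d {T : measurableType d}
    (psi : R -> R) (Q P : probability T R) : \bar R :=
  if pselect (Q `<< P) then
    (\int[P]_x (psi (fine (Radon_Nikodym_SigmaFinite.f Q P x)))%:E)%E
  else +oo%E.

(* Main.v *)
Require Import Defs.
From HB Require Import structures.
From mathcomp Require Import all_boot all_order all_algebra.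
From mathcomp Require Import all_classical all_reals all_analysis.
From mathcomp Require Import measurable_realfun ring lra.

(** Write h = dQ/dP and let p be the slope of psi at 1. Subtracting from psi
    its tangent line at 1 does not change the entropy, since the integral of
    h - 1 vanishes, and leaves phi u = psi u - p (u - 1), which dominates
    a multiple of (u - 1)^2 on bounded intervals by uniform convexity, and u at
    infinity by superlinearity.
    Both regimes are captured by one inequality, [sqr_dist1_le]:
      (u - 1)^2 <= K (u + 1) phi u   for all u >= 0.
    Since u + 1 has integral 2 under the law of h, the Cauchy-Schwarz inequality
    gives (integral of |h - 1|)^2 <= 2 K I, where I is the entropy.

    The Cauchy-Schwarz step is carried out pointwise: by the inequality between
    arithmetic and geometric means, 2 t |u - 1| - t^2 (u + 1) <= K phi u for
    every t ([sqr_dist1_tangents]). Integrating gives 2 t V - 2 t^2 <= K I, with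
    V the integral of |h - 1|, and t = V / 2 is the best choice. This form only
    asks that psi o h have an integrable minorant, so the entropy may be
    infinite a priori and its negative part needs no separate treatment
    ([rel_entropy_ge]).

    Finally, the total variation of P - Q is the sum of |P - Q| over the two
    pieces of a Hahn decomposition, and |P A - Q A| is at most the integral of
    |h - 1| over A ([tv_dist_density_le]). When Q is not absolutely continuous
    the right-hand side is infinite. *)

Set Implicit Arguments.
Unset Strict Implicit.
Unset Printing Implicit Defensive.

Import Order.TTheory GRing.Theory Num.Theory.
Import numFieldNormedType.Exports.

Local Open Scope classical_set_scope.
Local Open Scope ring_scope.

(** * Calculus with derivatives taken within a set *)

Lemma derivable_within_continuous_at (R : realType) (D : set R) (f : R -> R)
    (x : R) :
  derivable_within D f x -> f y @[y --> within D (nbhs x)] --> f x.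
Proof.
move=> fx.
have fxE : f y @[y --> within D x^'] --> f x.
  rewrite [X in X @ _ --> _](_ : _ =
      fun y => f x + diff_quotient f x y * (y - x)); last first.
    apply/funext => y; rewrite /diff_quotient.
    have [->|yx] := eqVneq y x; first by rewrite subrr !mul0r addr0.
    by rewrite divfK ?subr_eq0// subrKC.
  set l := derive_within D f x.
  rewrite -[X in _ --> X](_ : f x + l * (x - x) = _); last first.
    by rewrite subrr mulr0 addr0.
  apply: cvgD; first exact: cvg_cst.
  apply: cvgM; first exact: fx.
  apply: cvgB; last exact: cvg_cst.
  by apply: cvg_trans (cvg_within _) _; exact: cvg_within.
move=> V fV.
have fV' : \forall y \near x, y != x -> D y -> V (f y) := fxE _ fV.
suff : \forall y \near x, D y -> V (f y) by [].
apply: filterS fV' => y yV Dy.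
have [->|yx] := eqVneq y x; first exact: nbhs_singleton fV.
exact: yV.
Qed.

(** One-sidedness disappears in the interior of D, where x^' already lies in D
    near x; this is what makes the mean value theorem available. *)
Lemma derivable_within_is_derive (R : realType) (D : set R) (f : R -> R)
    (x : R) :
  D° x -> derivable_within D f x -> is_derive x 1 f (derive_within D f x).
Proof.
move=> Dx fx.
suff h : h^-1 *: ((f \o shift x) (h *: 1) - f x) @[h --> 0^'] -->
    derive_within D f x.
  by split; [apply/cvg_ex; exists (derive_within D f x) | exact: cvg_lim h].
apply/cvgrPdist_lt => e e0.
move/cvgrPdist_lt : (fx) => /(_ e e0).
rewrite !near_withinE -/(derive_within D f x) => H.
have {}H : \forall y \near x, y != x ->
    `|derive_within D f x - diff_quotient f x y| < e.
  apply: filterS2 H Dx => y H Dy yx; exact: H.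
move/nbhs_ballP : H => [r /= r0 H].
apply/nbhs_ballP; exists r => // y; rewrite /ball/= sub0r normrN => yr y0.
have := H (y + x); rewrite /ball/= opprD addrCA subrr addr0 normrN => /(_ yr).
rewrite -subr_eq0 addrK => /(_ y0).
by rewrite /diff_quotient addrK mulrC /GRing.scale/= mulr1.
Qed.

Lemma derive_within_itvcy (R : realType) (f : R -> R) :
  (forall x, `[0, +oo[%classic x -> derivable_within `[0, +oo[ f x) ->
  {within `[0, +oo[, continuous f} /\
  (forall x : R, 0 < x -> is_derive x 1 f (derive_within `[0, +oo[ f x)).
Proof.
move=> df; split.
  apply/subspace_continuousP => x Dx.
  exact/derivable_within_continuous_at/df.
move=> x x0; apply: derivable_within_is_derive; last first.
  by apply: df; rewrite /= in_itv/= andbT ltW.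
have : nbhs x [set y : R | 0 < y] by exact: lt_nbhsr.
by apply: filterS => y /= y0; rewrite in_itv/= andbT ltW.
Qed.

Lemma increment_derive_within (R : realType) (f : R -> R) (A a x y : R) :
  (forall z, `[0, +oo[%classic z -> derivable_within `[0, +oo[ f z) ->
  (forall z : R, 0 <= z <= A -> a <= derive_within `[0, +oo[ f z) ->
  0 <= x -> x <= y -> y <= A -> a * (y - x) <= f y - f x.
Proof.
move=> /derive_within_itvcy[cf df] fa x0.
rewrite le_eqVlt => /predU1P[->|xy] yA.
  by rewrite !subrr mulr0.
have [z| |z] := @MVT R f (derive_within `[0, +oo[ f) x y xy.
- by rewrite in_itv/= => /andP[xz _]; apply: df; exact: le_lt_trans xz.
- apply: continuous_subspaceW cf => z /=; rewrite !in_itv/= andbT => /andP[+ _].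
  exact: le_trans.
- rewrite in_itv/= => /andP[xz zy] ->; rewrite ler_wpM2r ?subr_ge0 ?(ltW xy)//.
  by apply: fa; rewrite (le_trans x0 (ltW xz)) (le_trans (ltW zy)).
Qed.

(** Second-order Taylor bound. The difference g of both sides is minimal at v:
    by the increment bound on f', its derivative has the sign of x - v. The mean
    value theorem is applied between u and v, so that the interval may touch 0,
    where f has a one-sided derivative only. *)
Lemma quadratic_tangent_bound (R : realType) (f : R -> R) (A a u v : R) :
  C2_within `[0, +oo[ f ->
  (forall z : R, 0 <= z <= A -> a <= derive2_within `[0, +oo[ f z) ->
  0 <= u <= A -> 0 <= v <= A ->
  f v + derive_within `[0, +oo[ f v * (u - v) + a / 2 * (u - v) ^+ 2 <= f u.
Proof.
move=> [df ddf _] fa /andP[u0 uA] /andP[v0 vA].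
have [cf isdf] := derive_within_itvcy df.
set p := derive_within _ f v.
pose g x := f x - p * x - a / 2 * (x - v) ^+ 2.
pose dg x := derive_within `[0, +oo[ f x - p - a * (x - v).
have isdg (x : R) : 0 < x -> is_derive x 1 g (dg x).
  move=> /isdf ?.
  rewrite /g; apply: is_derive_eq; rewrite /dg /GRing.scale/=; lra.
have mvt (x y : R) : 0 <= x -> x < y ->
    exists2 z, x < z < y & g y - g x = dg z * (y - x).
  move=> x0 xy; have [z| |z] := @MVT R g dg x y xy.
  - by rewrite in_itv/= => /andP[xz _]; apply: isdg; exact: le_lt_trans xz.
  - have c2 : continuous (fun x : R => - (p * x) - a / 2 * (x - v) ^+ 2).
      move=> z; apply: cvgB; first
        by apply: cvgN; apply: cvgM; [exact: cvg_cst|exact: cvg_id].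
      apply: cvgM; first exact: cvg_cst.
      by apply: cvgM; apply: cvgB; [exact: cvg_id|exact: cvg_cst|
        exact: cvg_id|exact: cvg_cst].
    have -> : g = fun x => f x + (- (p * x) - a / 2 * (x - v) ^+ 2).
      by apply/funext => z; rewrite /g addrA.
    have cf' : {within `[x, y], continuous f}.
      apply: continuous_subspaceW cf => z /=.
      by rewrite !in_itv/= andbT => /andP[+ _]; exact: le_trans.
    move=> z; apply: cvgD; first exact: cf'.
    exact: (continuous_subspaceT c2).
  - by rewrite in_itv/= => zxy gE; exists z.
have incr x y := @increment_derive_within R _ A a x y ddf fa.
have gvu : g v <= g u.
  have [uv|vu|->//] := ltgtP u v.
  - have [z /andP[uz zv] gE] := mvt _ _ u0 uv.
    have zpv := incr z v (le_trans u0 (ltW uz)) (ltW zv) vA.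
    rewrite -subr_le0 gE mulr_le0_ge0 ?subr_ge0 ?(ltW uv)//.
    by rewrite /dg /p; lra.
  - have [z /andP[vz zu] gE] := mvt _ _ v0 vu.
    have vpz := incr v z v0 (ltW vz) (le_trans (ltW zu) uA).
    rewrite -subr_ge0 gE mulr_ge0 ?subr_ge0 ?(ltW vu)//.
move: gvu; rewrite /g /p; lra.
Qed.

(** * Total variation and integrals *)

(** The integral of g is meaningful, possibly +oo, because its negative part is
    controlled by that of f. *)
Lemma le_integral_integrable_minorant d (T : measurableType d) (R : realType)
    (mu : {measure set T -> \bar R}) (D : set T) (f g : T -> \bar R) :
  measurable D -> mu.-integrable D f -> measurable_fun D g ->
  {in D, forall x, f x <= g x}%E ->
  (\int[mu]_(x in D) f x <= \int[mu]_(x in D) g x)%E.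
Proof.
move=> mD intf mg fg; rewrite integralE [leRHS]integralE.
have mf : measurable_fun D f by exact: measurable_int intf.
apply: leeB; apply: ge0_le_integral => //;
  try exact: measurable_funepos; try exact: measurable_funeneg.
  by move=> x /mem_set; exact: funepos_le.
by move=> x /mem_set; exact: funeneg_le.
Qed.

Lemma integrable_dist1 d (T : measurableType d) (R : realType)
    (P : probability T R) (h : T -> R) :
  P.-integrable [set: T] (EFin \o h) ->
  P.-integrable [set: T] (EFin \o (fun x => `|h x - 1|)).
Proof.
move=> inth; have int1 := finite_measure_integrable_cst P 1 measurableT.
exact: integrable_norm (integrableB measurableT inth int1).
Qed.

Lemma tv_dist_density_le d (T : measurableType d) (R : realType)
    (P Q : probability T R) (h : T -> R) :
  P.-integrable [set: T] (EFin \o h) ->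
  (forall A, measurable A -> Q A = \int[P]_(x in A) (h x)%:E)%E ->
  (tv_dist P Q <= \int[P]_x `|h x - 1|%:E)%E.
Proof.
move=> inth Qh; rewrite /tv_dist /tv_norm.
case: cid => X /= XP; case: cid => Y /= nuXY.
have [[mX _] [mY _] XYT XY0] := nuXY.
have int1 : P.-integrable [set: T] (cst 1%E).
  exact: finite_measure_integrable_cst.
have intBh : P.-integrable [set: T] (EFin \o (fun x => 1 - h x)).
  exact: (integrableB measurableT int1 inth).
have intn := integrable_dist1 inth.
have sub (A : set T) f : measurable A -> P.-integrable [set: T] f ->
    P.-integrable A f.
  by move=> mA; apply: integrableS.
rewrite -XYT ge0_integral_setU //=; last 2 first.
- by rewrite XYT; exact: measurable_int intn.
- by rewrite disj_set2E XY0.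
rewrite /charge_variation jordan_posE jordan_negE cjordan_posE cjordan_negE.
rewrite /crestr0 mem_set// /crestr /cadd/= /copp /charge_of_finite_measure
  XYT // !setTI.
have sub_int A : measurable A ->
    (P A - Q A)%E = (\int[P]_(x in A) (1 - h x)%:E)%E.
  move=> mA; rewrite Qh// -[X in (X - _)%E](mul1e (P A)) -integral_cst//.
  by rewrite -integralB_EFin//; exact: sub.
have cE A : cadd (charge_of_finite_measure P)
    (copp (charge_of_finite_measure Q)) A = (P A - Q A)%E by [].
have le_abs A : measurable A ->
    (`|P A - Q A| <= \int[P]_(x in A) `|h x - 1|%:E)%E.
  move=> mA; rewrite sub_int//.
  rewrite (le_trans (le_abse_integral _ _ _))//.
    exact: measurable_int (sub _ _ mA intBh).
  by under eq_integral do rewrite abse_EFin distrC.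
rewrite [X in (X - _)%E]cE [X in (_ - X)%E]cE; apply: leeD.
  exact: le_trans (lee_abs _) (le_abs X mX).
by rewrite (le_trans (lee_abs _))// abseN le_abs.
Qed.

(** * The inequality between |u - 1| and psi *)

(** A set that is not bounded below has inf 0 by convention. *)
Lemma inf_gt0_le (R : realType) (S : set R) (x : R) :
  0 < inf S -> S x -> inf S <= x.
Proof.
move=> S0 Sx; apply: ge_inf => //.
have [[]//|/inf_out S0'] := pselect (has_inf S).
by rewrite S0' ltxx in S0.
Qed.

(** Let A >= 1 be such that psi u >= (|p| + 1) u for u > A. Below A, the tangent
    bound gives phi >= a / 2 (u - 1)^2, with a the infimum of psi'' on [0, A];
    above A, phi >= u >= u - 1 gives (u - 1)^2 <= (u + 1) phi. The sum of the
    two constants 2 / a and 1 serves on both ranges. *)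
Lemma sqr_dist1_le (R : realType) (psi : R -> R) :
  C2_within `[0, +oo[ psi ->
  (forall A : R, 0 < A ->
    0 < inf [set derive2_within `[0, +oo[ psi v | v in `[0, A]]) ->
  psi 1 = 0 ->
  psi u / u @[u --> +oo] --> +oo ->
  exists p K : R, 0 < K /\ forall u, 0 <= u ->
    (u - 1) ^+ 2 <= K * (u + 1) * (psi u - p * (u - 1)).
Proof.
move=> C2 unif psi1 superlin.
pose p := derive_within `[0, +oo[ psi 1; exists p.
move/cvgryPge : superlin => /(_ (`|p| + 1)) [A0 [_ hA0]].
pose A := Num.max A0 1.
have A1 : 1 <= A by rewrite le_max lexx orbT.
have A_gt0 : 0 < A by exact: lt_le_trans A1.
pose a : R := inf [set derive2_within `[0, +oo[ psi v | v in `[0, A]].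
have a_gt0 : 0 < a := unif A A_gt0.
exists (1 + 2 / a); split; first by rewrite addr_gt0// divr_gt0.
move=> u u0; have [uA|Au] := leP u A.
- have h := @quadratic_tangent_bound R psi A a u 1 C2.
  have {}h : p * (u - 1) + a / 2 * (u - 1) ^+ 2 <= psi u.
    rewrite -[leLHS]add0r -psi1 addrA; apply: h => //.
    + by move=> z zA; apply: inf_gt0_le => //; exists z; rewrite //= in_itv.
    + by rewrite u0.
    + by rewrite ler01.
  set phi := psi u - _.
  have phi_ge : (u - 1) ^+ 2 <= 2 / a * phi.
    rewrite mulrAC ler_pdivlMr//.
    rewrite /phi; lra.
  have phi0 : 0 <= phi.
    have := le_trans (sqr_ge0 _) phi_ge.
    by rewrite pmulr_rge0 ?divr_gt0.
  have : 0 <= (u + (2 / a) * u ) * phi.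
    by rewrite mulr_ge0// addr_ge0// mulr_ge0// divr_ge0// ltW.
  by move: phi_ge phi0; lra.
- have u1 : 1 < u by exact: le_lt_trans Au.
  have : `|p| + 1 <= psi u / u.
    by apply: hA0; rewrite (le_lt_trans _ Au)// le_max lexx.
  rewrite ler_pdivlMr; last by lra.
  move=> psi_ge.
  have pu : p * (u - 1) <= `|p| * u.
    apply: (@le_trans _ _ (`|p| * (u - 1))).
      by rewrite ler_wpM2r ?ler_norm//; lra.
    by rewrite ler_wpM2l//; lra.
  set phi := psi u - _.
  have phiu : u <= phi by rewrite /phi; lra.
  have : (u - 1) ^+ 2 <= (u + 1) * phi.
    by rewrite expr2; apply: ler_pM; lra.
  have : 0 <= 2 / a * ((u + 1) * phi).
    by rewrite !mulr_ge0 ?invr_ge0 ?(ltW a_gt0)//; lra.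
  by lra.
Qed.

(** Expand (t (u + 1) - |u - 1|)^2 >= 0 and divide by u + 1. *)
Lemma sqr_dist1_tangents (R : realType) (K t u phi : R) :
  0 < K -> 0 <= u -> (u - 1) ^+ 2 <= K * (u + 1) * phi ->
  K^-1 * (2 * t * `|u - 1| - t ^+ 2 * (u + 1)) <= phi.
Proof.
move=> K0 u0 h; rewrite mulrC ler_pdivrMr//.
have u1 : 0 < u + 1 by lra.
rewrite -(ler_pM2r u1).
have := sqr_ge0 (t * (u + 1) - `|u - 1|).
rewrite sqrrB real_normK ?num_real//.
by lra.
Qed.

(** * The density and the entropy *)

Definition density (R : realType) d (T : measurableType d)
    (P Q : probability T R) (x : T) : R :=
  fine (Radon_Nikodym_SigmaFinite.f Q P x).

Lemma density_ge0 (R : realType) d (T : measurableType d)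
    (P Q : probability T R) (x : T) :
  Q `<< P -> 0 <= density P Q x.
Proof. by move=> QP; rewrite fine_ge0// Radon_Nikodym_SigmaFinite.f_ge0. Qed.

Lemma EFin_density (R : realType) d (T : measurableType d)
    (P Q : probability T R) :
  Q `<< P -> EFin \o density P Q = Radon_Nikodym_SigmaFinite.f Q P.
Proof.
by move=> QP; apply/funext => x /=; rewrite fineK//;
  rewrite Radon_Nikodym_SigmaFinite.f_fin_num.
Qed.

Lemma integrable_density (R : realType) d (T : measurableType d)
    (P Q : probability T R) :
  Q `<< P -> P.-integrable [set: T] (EFin \o density P Q).
Proof.
by move=> QP; rewrite EFin_density//;
  exact: Radon_Nikodym_SigmaFinite.f_integrable.
Qed.

Lemma integral_density (R : realType) d (T : measurableType d)
    (P Q : probability T R) (A : set T) :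
  Q `<< P -> measurable A ->
  (Q A = \int[P]_(x in A) (density P Q x)%:E)%E.
Proof.
by move=> QP mA; rewrite (Radon_Nikodym_SigmaFinite.f_integral QP mA);
  rewrite -EFin_density//.
Qed.

(** A minorant of psi of the form a |u - 1| + b u + c integrates explicitly,
    because h and 1 both have integral 1. *)
Lemma rel_entropy_ge (R : realType) (psi : R -> R) (a b c : R) d
    (T : measurableType d) (P Q : probability T R) :
  measurable_fun (`[0, +oo[%classic : set R) psi ->
  (forall u, 0 <= u -> a * `|u - 1| + b * u + c <= psi u) ->
  Q `<< P ->
  (a%:E * \int[P]_x `|density P Q x - 1|%:E + (b + c)%:E <=
    rel_entropy psi Q P)%E.
Proof.
move=> mpsi psi_ge QP; rewrite /rel_entropy; case: pselect => // {}QP.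
rewrite -/(density P Q _); set h := density P Q.
have inth : P.-integrable [set: T] (EFin \o h) := integrable_density QP.
have inth1 : (\int[P]_x (h x)%:E = 1)%E.
  by rewrite -(integral_density QP)// probability_setT.
have int1 r : P.-integrable [set: T] (EFin \o cst r).
  exact: finite_measure_integrable_cst.
have intn := integrable_dist1 inth.
have mh : measurable_fun [set: T] h.
  exact/measurable_EFinP/(measurable_int P).
have -> : (a%:E * \int[P]_x `|h x - 1|%:E + (b + c)%:E =
    \int[P]_x (a%:E * `|h x - 1|%:E + b%:E * (h x)%:E + c%:E))%E.
  rewrite integralD//; [|exact: integrableD (integrableZl _ _ intn)
    (integrableZl _ _ inth)|exact: (int1 c)].
  rewrite integralD//; [|exact: integrableZl|exact: integrableZl].
  rewrite !integralZl// inth1 mule1 integral_cst//.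
  by rewrite [X in (c%:E * X)%E](probability_setT P) mule1 EFinD addeA.
apply: le_integral_integrable_minorant => //.
- apply: integrableD => //; last exact: (int1 c).
  by apply: integrableD => //; exact: integrableZl.
- apply/measurable_EFinP; apply: (measurable_comp _ _ mpsi mh) => //.
  by move=> _ [x _ <-] /=; rewrite in_itv/= density_ge0.
- move=> x _; rewrite -!EFinM -!EFinD lee_fin.
  exact: (psi_ge (h x) (density_ge0 x QP)).
Qed.

Theorem lemma1p1 (R : realType) (psi : R -> R)
    (psi_C2 : C2_within `[0, +oo[ psi)
    (psi_convex : convex_function (`[0, +oo[%classic : set R) psi)
    (psi_unif_convex : forall A : R, 0 < A ->
      0 < inf [set derive2_within `[0, +oo[ psi v | v in `[0, A]])
    (psi1 : psi 1 = 0)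
    (psi_superlinear : psi u / u @[u --> +oo] --> +oo) :
  exists c : R, 0 < c /\
    forall (d : measure_display) (T : measurableType d)
      (P Q : probability T R),
      (tv_dist P Q <= c%:E * sqrte (rel_entropy psi Q P))%E.
Proof.
have [p [K [K0 bound]]] :=
  sqr_dist1_le psi_C2 psi_unif_convex psi1 psi_superlinear.
have c0 : 0 < Num.sqrt (2 * K) by rewrite sqrtr_gt0 mulr_gt0.
exists (Num.sqrt (2 * K)); split=> // d T P Q.
have [QP|nQP] := pselect (Q `<< P); last first.
  rewrite /rel_entropy; case: pselect => //= _.
  by rewrite gt0_muley ?lte_fin// leey.
have mpsi : measurable_fun (`[0, +oo[%classic : set R) psi.
  apply: subspace_continuous_measurable_fun => //.
  by have [dpsi _ _] := psi_C2; have [] := derive_within_itvcy dpsi.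
set h := density P Q.
set I := rel_entropy psi Q P.
pose V : R := fine (\int[P]_x `|h x - 1|%:E)%E.
have inth := integrable_density QP.
have VE : (\int[P]_x `|h x - 1|%:E = V%:E)%E.
  by rewrite /V fineK//; exact/integrable_fin_num/integrable_dist1.
have V0 : 0 <= V by rewrite fine_ge0// integral_ge0// => x _; rewrite lee_fin.
have tvV : (tv_dist P Q <= V%:E)%E.
  by rewrite -VE; apply: tv_dist_density_le => // A; exact: integral_density.
apply: (le_trans tvV).
(* The value of t that maximizes 2 t V - 2 t^2. *)
pose t : R := V / 2.
have : ((V ^+ 2 / (2 * K))%:E <= I)%E.
  have := @rel_entropy_ge R psi (K^-1 * (2 * t)) (p - K^-1 * t ^+ 2)
     (- (p + K^-1 * t ^+ 2)) d T P Q mpsi.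
  rewrite VE -EFinM -EFinD => /(_ _ QP) HI; apply: le_trans (HI _).
    rewrite lee_fin /t le_eqVlt; apply/orP; left; apply/eqP.
    field; lra.
  move=> u u0; have := sqr_dist1_tangents t K0 u0 (bound u u0).
  rewrite -(lerD2r (p * (u - 1))) subrK; apply: le_trans.
  by rewrite le_eqVlt; apply/orP; left; apply/eqP; ring.
case: I => [I| |]//=.
- rewrite !lee_fin ler_pdivrMr ?mulr_gt0// => VI.
  have I0 : 0 <= I.
    by have := le_trans (sqr_ge0 _) VI; rewrite pmulr_lge0// mulr_gt0.
  rewrite -sqrtrM ?mulr_ge0 ?(ltW K0)//.
  by rewrite -(ger0_norm V0) -sqrtr_sqr ler_wsqrtr// mulrC.
- by move=> _; rewrite gt0_muley ?lte_fin// leey.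
Qed.
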